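(* Let $\mathbb{F}$ be a finite field, let $n \geq 3$, and let $A$ be an $n\times n$ matrix over $\mathbb{F}$. Define $Q:\mathbb{F}^n\to\mathbb{F}$ by $Q(x)=x^TAx$. Then there exists a non-zero vector $v\in\mathbb{F}^n$ such that $Q(v)=0$. *)

(* Defs.v *)
From mathcomp Require Import all_boot all_order all_algebra.
Set Implicit Arguments.
Unset Strict Implicit.
Unset Printing Implicit Defensive.
Import GRing.Theory.
Local Open Scope ring_scope.

(* The 1 x 1 matrix x^T A x is identified with its unique entry. *)
Definition quad_form (F : finFieldType) (n : nat) (A : 'M[F]_n)
  (x : 'cV[F]_n) : F := (x^T *m A *m x) ord0 ord0.

(* Main.v *)
Require Import Defs.
From mathcomp Require Import all_boot all_order all_algebra all_field.
Set Implicit Arguments.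
Unset Strict Implicit.
Unset Printing Implicit Defensive.
Import GRing.Theory.
Local Open Scope ring_scope.

(** The argument is the one of Chevalley and Warning.  Let q be the order of F.
    The function v |-> 1 - Q(v)^(q-1) is the indicator of the zero set of Q, so
    if 0 were the only zero of Q, its sum over F^n would be 1.  But this
    function is a polynomial of degree at most 2(q-1), and any polynomial of
    degree less than n(q-1) has sum 0 over F^n: each of its monomials has an
    exponent smaller than q-1 in some variable, and the sum over t in F of t^k
    is 0 for k < q-1 ([sum_expr_finField], [sum_monomial]).  Since
    2(q-1) < n(q-1) for n >= 3, this is a contradiction.

    Expanding Q^(q-1) into monomials is avoided: [sum_quad_form_monomial]
    multiplies the powers of Q by an arbitrary monomial, and trades one factor
    Q at a time for two units of degree of that monomial. *)

(** The polynomial 'X^k - 1 has at most k roots. *)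
Lemma exists_expr_neq1 (F : finFieldType) (k : nat) :
  (0 < k < #|F|.-1)%N -> exists2 a : F, a != 0 & a ^+ k != 1.
Proof.
case/andP=> k_gt0 k_lt.
have [/exists_inP[a a_neq0 ak_neq1] | ] :=
    boolP [exists a in predC1 (0 : F), a ^+ k != 1]; first by exists a.
rewrite negb_exists_in => /forall_inP all_roots.
suff : (#|predC1 (0%R : F)| <= k)%N by rewrite cardC1 leqNgt k_lt.
rewrite cardE; apply: (max_unity_roots k_gt0 _ (enum_uniq _)).
by apply/allP=> a; rewrite mem_enum unity_rootE => /all_roots; rewrite negbK.
Qed.

(** Substituting t + 1 for t in the sum of all t (when k = 0), or a * t for t
    with a ^+ k != 1 (when k > 0), permutes the terms. *)
Lemma sum_expr_finField (F : finFieldType) (k : nat) :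
  (k < #|F|.-1)%N -> \sum_(t : F) t ^+ k = 0.
Proof.
case: (posnP k) => [-> _ | k_gt0 k_lt].
  apply: (addrI (\sum_(t : F) t)); rewrite addr0 -big_split /=.
  rewrite [RHS](reindex_inj (addIr 1)).
  by apply: eq_bigr => t _; rewrite expr0.
have /exists_expr_neq1[a a_neq0 ak_neq1] : (0 < k < #|F|.-1)%N by rewrite k_gt0.
have scale_sum : a ^+ k * (\sum_(t : F) t ^+ k) = \sum_(t : F) t ^+ k.
  rewrite [RHS](reindex_inj (mulfI a_neq0)) mulr_sumr.
  by apply: eq_bigr => t _; rewrite exprMn.
apply/eqP; move/eqP: scale_sum.
by rewrite -subr_eq0 -{2}[\sum_t _]mul1r -mulrBl mulf_eq0 subr_eq0 (negPf ak_neq1).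
Qed.

(** The sum factors as the product over i of the power sums of exponent e i,
    and by pigeonhole some e i is less than #|F|.-1. *)
Lemma sum_monomial (F : finFieldType) (n : nat) (e : 'I_n -> nat) :
  (\sum_i e i < n * #|F|.-1)%N ->
  \sum_(v : 'cV[F]_n) \prod_i v i ord0 ^+ e i = 0.
Proof.
move=> deg_e.
have -> : \sum_(v : 'cV[F]_n) \prod_i v i ord0 ^+ e i
          = \prod_i \sum_(t : F) t ^+ e i.
  rewrite bigA_distr_bigA /=.
  rewrite (reindex (fun f : {ffun 'I_n -> F} => \col_i f i)) /=.
    by apply: eq_bigr => f _; apply: eq_bigr => i _; rewrite mxE.
  exists (fun v : 'cV[F]_n => [ffun i => v i ord0]) => [f | v] _.
    by apply/ffunP=> i; rewrite ffunE mxE.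
  by apply/colP=> i; rewrite mxE ffunE.
have [/existsP[i ei_lt] | ] := boolP [exists i, e i < #|F|.-1]%N.
  by rewrite (bigD1 i) //= sum_expr_finField // mul0r.
rewrite negb_exists => /forallP e_ge; move: deg_e; rewrite ltnNge.
case/negP; rewrite -[X in (X * _)%N]card_ord -sum_nat_const.
by apply: leq_sum => i _; rewrite leqNgt e_ge.
Qed.

Lemma quad_formE (F : finFieldType) (n : nat) (A : 'M[F]_n) (v : 'cV[F]_n) :
  quad_form A v = \sum_j \sum_i A i j * (v i ord0 * v j ord0).
Proof.
rewrite /quad_form mxE; apply: eq_bigr => j _.
rewrite mxE mulr_suml; apply: eq_bigr => i _.
by rewrite mxE mulrAC mulrC.
Qed.

Lemma prod_expr_incr (R : comPzRingType) (I : finType) (x : I -> R)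
    (e : I -> nat) (j : I) :
  \prod_i x i ^+ (e i + (i == j)) = x j * \prod_i x i ^+ e i.
Proof.
rewrite (eq_bigr _ (fun i _ => exprD (x i) _ _)) big_split mulrC /=; congr (_ * _).
by rewrite (bigD1 j) //= eqxx expr1 big1 ?mulr1 // => i /negPf->.
Qed.

Lemma sum_incr (I : finType) (e : I -> nat) (j : I) :
  (\sum_i (e i + (i == j)) = (\sum_i e i).+1)%N.
Proof.
rewrite big_split /= -addn1; congr addn.
by rewrite (bigD1 j) //= eqxx big1 // => i /negPf->.
Qed.

(** Generalizing over the monomial is what lets the induction on m go through:
    expanding one factor Q only changes the exponents e. *)
Lemma sum_quad_form_monomial (F : finFieldType) (n : nat) (A : 'M[F]_n)
    (m : nat) (e : 'I_n -> nat) :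
  (2 * m + \sum_i e i < n * #|F|.-1)%N ->
  \sum_(v : 'cV[F]_n) quad_form A v ^+ m * \prod_i v i ord0 ^+ e i = 0.
Proof.
elim: m e => [|m IHm] e deg_e.
  rewrite -[RHS](sum_monomial deg_e).
  by apply: eq_bigr => v _; rewrite expr0 mul1r.
pose e' k l i := (e i + (i == l) + (i == k))%N.
transitivity (\sum_l \sum_k A k l *
    (\sum_(v : 'cV[F]_n) quad_form A v ^+ m * \prod_i v i ord0 ^+ e' k l i)).
  under [RHS]eq_bigr => l _ do
    (under eq_bigr => k _ do rewrite mulr_sumr; rewrite exchange_big /=).
  rewrite exchange_big; apply: eq_bigr => v _ /=.
  rewrite exprS {1}quad_formE -mulrA mulr_suml; apply: eq_bigr => l _.
  rewrite mulr_suml; apply: eq_bigr => k _.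
  rewrite !prod_expr_incr -!mulrA; congr (_ * _).
  by rewrite [RHS]mulrCA; congr (_ * _); rewrite mulrCA.
rewrite big1 // => l _; rewrite big1 // => k _; rewrite IHm ?mulr0 //.
by move: deg_e; rewrite !sum_incr mulnSr -addnA add2n.
Qed.

Theorem proposition1 (F : finFieldType) (n : nat) (hn : (3 <= n)%N)
  (A : 'M[F]_n) :
  exists v : 'cV[F]_n, v != 0 /\ quad_form A v = 0.
Proof.
have [/existsP[v /andP[v_neq0 /eqP Qv0]] | ] :=
    boolP [exists v : 'cV[F]_n, (v != 0) && (quad_form A v == 0)].
  by exists v.
rewrite negb_exists => /forallP anisotropic; exfalso.
have q_gt0 : (0 < #|F|.-1)%N by rewrite -subn1 subn_gt0 finNzRing_gt1.
have sum_pow m : (m <= #|F|.-1)%N ->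
    \sum_(v : 'cV[F]_n) quad_form A v ^+ m = 0.
  move=> le_m; rewrite -[RHS](@sum_quad_form_monomial F n A m (fun=> 0%N)).
    by apply: eq_bigr => v _; rewrite big1 ?mulr1.
  rewrite big1 // addn0 (@leq_ltn_trans (2 * #|F|.-1)) ?leq_mul2l //.
  by rewrite ltn_mul2r q_gt0.
have : \sum_(v : 'cV[F]_n) (1 - quad_form A v ^+ #|F|.-1) = 0.
  rewrite sumrB (sum_pow _ (leqnn _)) subr0.
  (* The constant 1 is the zeroth power of Q. *)
  exact: (sum_pow 0%N).
apply/eqP; rewrite (bigD1 0) //= big1 => [|v v_neq0].
  rewrite /quad_form mulmx0 mxE expr0n.
  by rewrite eqn0Ngt q_gt0 subr0 addr0 oner_eq0.
have := anisotropic v; rewrite v_neq0 /= => Qv_neq0.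
apply/eqP; rewrite subr_eq0 eq_sym; apply/eqP/(mulfI Qv_neq0).
by rewrite mulr1 -exprS prednK ?expf_card // ltnW ?finNzRing_gt1.
Qed.
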